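(* Let $\mathcal{N}$ be a finite-dimensional complex $d$-locally diagonalizable nilpotent Lie algebra and let $\mathcal{R}$ be a maximal solvable extension of $\mathcal{N}$. Then $\mathcal{R}$ admits only inner derivations, i.e. $\operatorname{Der}(\mathcal{R})=\operatorname{InDer}(\mathcal{R})$.
   Context: All vector spaces and algebras are finite-dimensional over $\mathbb{C}$. Unless otherwise noted, solvable algebras are assumed non-nilpotent, and nilpotent algebras are assumed not characteristically nilpotent (a Lie algebra is characteristically nilpotent if all its derivations are nilpotent). The convention $\operatorname{ad}_x(y)=[y,x]$ is used, and $\operatorname{InDer}(\mathcal{L})=\{\operatorname{ad}_x : x\in\mathcal{L}\}$. Torus: a torus on a Lie algebra $\mathcal{L}$ is an abelian subalgebra of $\operatorname{Der}(\mathcal{L})$ consisting of semisimple (diagonalizable) endomorphisms; it is maximal if it is not strictly contained in another torus. For a maximal torus $\mathcal{T}$ on a nilpotent Lie algebra $\mathcal{N}$ and $\alpha\in\mathcal{T}^*$, put $\mathcal{N}_\alpha=\{n\in\mathcal{N} : t(n)=\alpha(t)n \ \forall t\in\mathcal{T}\}$ (root subspace) and $W=\{\alpha\in\mathcal{T}^* : \mathcal{N}_\alpha\neq0\}$, so $\mathcal{N}=\bigoplus_{\alpha\in W}\mathcal{N}_\alpha$. Nil-independence: derivations $d_1,\dots,d_s$ of $\mathcal{N}$ are nil-independent if $\sum_{i=1}^s c_id_i$ is non-nilpotent for all scalars $c_1,\dots,c_s\in\mathbb{C}$ that are not all zero. Maximal solvable extension: a solvable extension of $\mathcal{N}$ is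 a solvable Lie algebra $\mathcal{R}=\mathcal{N}\oplus\mathcal{Q}$ (direct sum of vector spaces) whose nilradical is $\mathcal{N}$, with $\mathcal{Q}$ a complementary subspace. It is maximal if $\dim\mathcal{Q}$ is maximal, i.e. no solvable Lie algebra with nilradical $\mathcal{N}$ has larger dimension. $d$-locally diagonalizable: for a nilpotent Lie algebra $\mathcal{N}$ one fixes a basis in which all nil-independent derivations are simultaneously represented by upper-triangular matrices (it is assumed a priori that they have this form; in particular this applies to the operators $\operatorname{ad}_{x}|_{\mathcal{N}}$, $x\in\mathcal{Q}$, for a maximal solvable extension $\mathcal{N}\oplus\mathcal{Q}$). The diagonal of a derivation is the diagonal part of its matrix in this basis. $\mathcal{N}$ is called $d$-locally diagonalizable if: (i) the diagonals of all nil-independent derivations generate a maximal torus $\mathcal{T}$ on $\mathcal{N}$; (ii) for each root subspace $\mathcal{N}_\alpha$ with respect to $\mathcal{T}$, the restriction to $\mathcal{N}_\alpha$ followed by projection onto $\mathcal{N}_\alpha$ (along the other root subspaces) of every nil-independent derivation is diagonal; (iii) $0\notin W$. *)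

(* Defs.v *)
From HB Require Import structures.
From mathcomp Require Import all_boot all_order all_algebra.
From mathcomp Require Import complex.
From mathcomp Require Import boolp classical_sets reals.
Set Implicit Arguments.
Unset Strict Implicit.
Unset Printing Implicit Defensive.
Import GRing.Theory.
Local Open Scope ring_scope.

HB.mixin Record isLieAlgebra (F : fieldType) L of Vector F L := {
  lie : L -> L -> L;
  lie_linear_l : forall z : L, linear (lie^~ z);
  lie_linear_r : forall z : L, linear (lie z);
  liexx : forall x : L, lie x x = 0;
  lie_jacobi : forall x y z : L,
    lie x (lie y z) + lie y (lie z x) + lie z (lie x y) = 0
}.

#[short(type="lieAlgType")]
HB.structure Definition LieAlgebra (F : fieldType) :=
  { L of isLieAlgebra F L & Vector F L }.

Section LieAlgebraTheory.
Variables (F : fieldType) (L : lieAlgType F).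
Implicit Types (U V : {vspace L}) (d : 'End(L)).

(* [U, V], the span of all brackets [u, v] with u in U and v in V; by
   bilinearity it is enough to bracket basis vectors. *)
Definition lie_prodv U V : {vspace L} :=
  <<[seq lie u v | u <- vbasis U, v <- vbasis V]>>%VS.

Definition lower_central U (n : nat) : {vspace L} :=
  iter n (fun V => lie_prodv V U) U.

Definition derived_series U (n : nat) : {vspace L} :=
  iter n (fun V => lie_prodv V V) U.

Definition lie_nilpotent U : Prop := exists n, lower_central U n = 0%VS.

Definition lie_solvable U : Prop := exists n, derived_series U n = 0%VS.

Definition lie_ideal U : Prop :=
  forall x u : L, u \in U -> lie x u \in U.

Definition is_nilradical U : Prop :=
  [/\ lie_ideal U, lie_nilpotent U &
      forall V, lie_ideal V -> lie_nilpotent V -> (V <= U)%VS].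

Definition Der : set 'End(L) :=
  [set d | forall x y : L, d (lie x y) = lie (d x) y + lie x (d y)]%classic.

(* ad_x (y) = [y, x] *)
Definition InDer : set 'End(L) :=
  [set d | exists x : L, forall y : L, d y = lie y x]%classic.

Definition nilpotent_end d : Prop :=
  exists n, forall x : L, iter n d x = 0.

Definition characteristically_nilpotent : Prop :=
  forall d, Der d -> nilpotent_end d.

Definition diagonalizable_end d : Prop :=
  exists e : (\dim {:L}).-tuple L,
    basis_of {:L} e /\ is_diag_mx (passmx.mxof e e d).

Definition is_torus (T : {vspace 'End(L)}) : Prop :=
  [/\ forall t, t \in T -> Der t,
      forall t u, t \in T -> u \in T -> (t \o u = u \o t)%VF &
      forall t, t \in T -> diagonalizable_end t].

Definition is_maximal_torus (T : {vspace 'End(L)}) : Prop :=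
  is_torus T /\ forall T', is_torus T' -> (T <= T')%VS -> T' = T.

Definition torus_dual (T : {vspace 'End(L)}) := 'Hom(subvs_of T, F^o).

Definition root_space T (alpha : torus_dual T) : set L :=
  [set n | forall t : subvs_of T, vsval t n = alpha t *: n]%classic.

Definition is_root T (alpha : torus_dual T) : Prop :=
  exists2 n : L, root_space alpha n & n != 0.

(* pi is the projection onto the root subspace of alpha along the other root
   subspaces; when T is a torus these span L and pi exists and is unique. *)
Definition is_root_projection T (alpha : torus_dual T) (pi : 'End(L)) : Prop :=
  (forall n, root_space alpha n -> pi n = n) /\
  (forall beta : torus_dual T, beta <> alpha ->
     forall n, root_space beta n -> pi n = 0).

Definition nil_independent (ds : seq 'End(L)) : Prop :=
  forall c : 'I_(size ds) -> F, (exists i, c i != 0) ->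
    ~ nilpotent_end (\sum_(i < size ds) c i *: ds`_i).

(* d is a member of some nil-independent family of derivations *)
Definition nil_independent_der d : Prop :=
  exists ds : seq 'End(L),
    [/\ forall d', d' \in ds -> Der d', nil_independent ds & d \in ds].

Section InBasis.
Variable e : (\dim {:L}).-tuple L.

(* [mxof e e d] acts on row vectors, so the usual matrix of [d], acting on
   column vectors, is its transpose. *)
Definition mx_end d : 'M[F]_(\dim {:L}) := (passmx.mxof e e d)^T.

Definition upper_triangular d : Prop :=
  forall i j : 'I_(\dim {:L}), (j < i)%N -> mx_end d i j = 0.

Definition diagonal_part d : 'End(L) :=
  passmx.hommx e e (diag_mx (\row_i mx_end d i i)).

(* The torus generated by the diagonals is their linear span, because the
   operators that are diagonal in the basis [e] commute. *)
Definition diagonals_generate (T : {vspace 'End(L)}) : Prop :=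
  (forall d, nil_independent_der d -> diagonal_part d \in T) /\
  (forall T' : {vspace 'End(L)},
     (forall d, nil_independent_der d -> diagonal_part d \in T') -> (T <= T')%VS).

(* "Diagonal" refers to the fixed basis [e]: since T is spanned by operators
   that are diagonal in [e], the vectors of [e] lying in a root subspace form
   a basis of it. *)
Definition diagonal_on_root_spaces (T : {vspace 'End(L)}) : Prop :=
  forall alpha : torus_dual T, is_root alpha ->
  exists2 pi : 'End(L), is_root_projection alpha pi &
  forall d, nil_independent_der d ->
  forall j : 'I_(\dim {:L}), root_space alpha e`_j ->
    pi (d e`_j) \in <[e`_j]>%VS.

End InBasis.

Definition d_locally_diagonalizable : Prop :=
  exists (e : (\dim {:L}).-tuple L) (T : {vspace 'End(L)}),
  [/\ basis_of {:L} e /\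
        (forall d, nil_independent_der d -> upper_triangular e d),
      is_maximal_torus T /\ diagonals_generate e T,
      diagonal_on_root_spaces e T &
      ~ is_root (0 : torus_dual T)].

End LieAlgebraTheory.

Arguments Der {F} L.
Arguments InDer {F} L.
Arguments characteristically_nilpotent {F} L.
Arguments d_locally_diagonalizable {F} L.

(* L is a solvable Lie algebra whose nilradical is the image of N under the
   Lie algebra embedding iota; the complementary space Q is any complement of
   this image, so that \dim Q = \dim L - \dim N. *)
Definition solvable_extension (F : fieldType) (N L : lieAlgType F)
    (iota : 'Hom(N, L)) : Prop :=
  [/\ lker iota = 0%VS,
      forall x y : N, iota (lie x y) = lie (iota x) (iota y),
      lie_solvable {:L} & is_nilradical (limg iota)].

Definition maximal_solvable_extension (F : fieldType) (N L : lieAlgType F)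
    (iota : 'Hom(N, L)) : Prop :=
  solvable_extension iota /\
  forall (L' : lieAlgType F) (iota' : 'Hom(N, L')),
    solvable_extension iota' -> (\dim {:L'} <= \dim {:L})%N.

(* Main.v *)
Require Import Defs.
From HB Require Import structures.
From mathcomp Require Import all_boot all_order all_algebra.
From mathcomp Require Import ring complex boolp classical_sets reals.
Set Implicit Arguments.
Unset Strict Implicit.
Unset Printing Implicit Defensive.
Import GRing.Theory Num.Theory passmx.
Local Open Scope ring_scope.

(** Since [N] has a non-nilpotent derivation, Der(N) is spanned by such, so
    every derivation of [N] is upper triangular with diagonal in [T]. Hence
    [x |-> diag (ad x)] maps [L] to [T]; its kernel is [N], and comparing [L]
    with the semidirect product of [N] and [T] shows that it is onto. Choose [x0]
    whose diagonal [t0] has no zero entry and takes distinct values on distinct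
    roots. As 0 is not a root, [ad x0] is invertible on [N], so [L] is the sum of
    [N] = [L, L] and the kernel [C] of [ad x0]. Every derivation of [L] preserves
    [N] and takes its values in [N]; adding inner derivations makes it vanish on
    [x0] and strictly triangular on [N]. It then kills [C], and on [N] it
    commutes with [ad x0]: on its first nonzero superdiagonal the (i, j) entry is
    multiplied by [t0_i - t0_j] in the commutator, so it can be nonzero only if
    [i] and [j] have the same root, which the d-local diagonalizability
    excludes. *)

(** * Polynomial arguments for nilpotent matrices *)

Lemma poly_nonroot (F : numFieldType) (p : {poly F}) :
  p != 0 -> exists c, p.[c] != 0.
Proof.
move=> p0; have [/allP Hr|/allPn[c _ pc0]] :=
  boolP (all (root p) [seq k%:R | k <- iota 0 (size p)]); last by exists c.
have := max_poly_roots p0 _ _; move=> /(_ _ (introT allP Hr)).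
rewrite map_inj_uniq ?iota_uniq ?size_map ?size_iota ?ltnn; first by move=> /(_ isT).
by move=> a b /eqP; rewrite eqr_nat => /eqP.
Qed.

(** The factor ['X] adds 0 to the roots, so for [p != 0] the nonzero polynomial [p * 'X] would
    vanish everywhere. *)
Lemma poly_eq0_away0 (F : numFieldType) (p : {poly F}) :
  (forall c, c != 0 -> p.[c] = 0) -> p = 0.
Proof.
move=> pz; apply/eqP/negPn/negP => p0.
have [|c] := @poly_nonroot F (p * 'X); first by rewrite mulf_neq0 ?polyX_eq0.
by rewrite hornerM hornerX; have [->|/pz ->] := eqVneq c 0; rewrite ?mulr0 ?mul0r ?eqxx.
Qed.

(** The minimal polynomial divides a power of ['X], hence is one, and by Cayley-Hamilton its degree
    is at most [n]. *)
Lemma mx_nilpotency_bound (F : fieldType) n (A : 'M[F]_n) k :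
  A ^+ k = 0 -> A ^+ n = 0.
Proof.
case: n A => [|n] A Ak; first by rewrite [LHS]flatmx0 [RHS]flatmx0.
have: mxminpoly A %| ('X - 0%:P) ^+ k.
  by rewrite dvd_mxminpoly subr0 rmorphXn /= horner_mx_X Ak.
case/dvdp_exp_XsubCP => j _ pj.
have := dvdp_leq (monic_neq0 (char_poly_monic A)) (mxminpoly_dvd_char A).
rewrite (eqp_size pj) size_exp_XsubC size_char_poly ltnS => jn.
have: mxminpoly A %| ('X^(n.+1) : {poly F}).
  by rewrite (eqp_dvdl _ pj) subr0 dvdp_exp2l.
by rewrite dvd_mxminpoly rmorphXn /= horner_mx_X => /eqP.
Qed.

(** With the uniform exponent [n], the entries of [(A + c *: B) ^+ n] are polynomials in [c] that
    vanish for [c != 0], hence also at 0. *)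
Lemma mx_nilpotent_limit (F : numFieldType) n (A B : 'M[F]_n) :
  (forall c, c != 0 -> exists k, (A + c *: B) ^+ k = 0) -> A ^+ n = 0.
Proof.
move=> nil.
pose P : 'M[{poly F}]_n := (map_mx polyC A + 'X *: map_mx polyC B) ^+ n.
have PE c : map_mx (horner_eval c) P = (A + c *: B) ^+ n.
  rewrite /P rmorphXn /= raddfD /= map_mxZ /= {2}/horner_eval hornerX.
  suff mapC (C : 'M[F]_n) : map_mx (horner_eval c) (map_mx polyC C) = C by rewrite !mapC.
  by apply/matrixP=> i j; rewrite !mxE /horner_eval hornerC.
have P0 : P = 0.
  apply/matrixP => i j; rewrite mxE; apply: poly_eq0_away0 => c c0.
  have [k /mx_nilpotency_bound] := nil c c0.
  by rewrite -PE => /matrixP /(_ i j); rewrite !mxE.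
have := PE 0; rewrite P0 scale0r addr0 => <-.
by apply/matrixP=> i j; rewrite !mxE /horner_eval horner0.
Qed.

(* [A] vanishes below the [k]-th superdiagonal. *)
Definition utri (F : fieldType) n k (A : 'M[F]_n) :=
  forall i j : 'I_n, (j < i + k)%N -> A i j = 0.

(** * Products and powers of triangular matrices *)

Section Utri.
Variables (F : fieldType) (n : nat).
Implicit Types A B : 'M[F]_n.

Lemma utri_big k A : (n <= k)%N -> utri k A -> A = 0.
Proof.
move=> nk uA; apply/matrixP => i j; rewrite mxE uA //.
by rewrite (leq_trans (ltn_ord j)) // (leq_trans nk) ?leq_addl.
Qed.

Lemma utriM k l A B : utri k A -> utri l B -> utri (k + l) (A *m B).
Proof.
move=> uA uB i j ij; rewrite mxE big1 // => m _.
have [mi|im] := ltnP m (i + k); first by rewrite uA ?mul0r.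
by rewrite uB ?mulr0 // (leq_trans ij) // addnA leq_add2r.
Qed.

(** In the sum over [m], the factor from [A] vanishes for [m < i] and the one from [B] for
    [m > i]. *)
Lemma utri_mul_diagl k A B (i j : 'I_n) : utri 0 A -> utri k B ->
  j = (i + k)%N :> nat -> (A *m B) i j = A i i * B i j.
Proof.
move=> uA uB ij; rewrite mxE (bigD1 i) //= big1 ?addr0 // => m mi.
have [im|im|im] := ltngtP m i; first by rewrite uA ?mul0r ?addn0.
  by rewrite uB ?mulr0 // ij ltn_add2r.
by move/val_inj: im mi => ->; rewrite eqxx.
Qed.

Lemma utri_mul_diagr k A B (i j : 'I_n) : utri 0 A -> utri k B ->
  j = (i + k)%N :> nat -> (B *m A) i j = B i j * A j j.
Proof.
move=> uA uB ij; rewrite mxE (bigD1 j) //= big1 ?addr0 // => m mj.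
have [jm|jm|jm] := ltngtP m j.
- by rewrite uB ?mul0r // -ij.
- by rewrite uA ?mulr0 ?addn0.
- by move/val_inj: jm mj => ->; rewrite eqxx.
Qed.

Lemma utri_exp_diag A k (i : 'I_n) : utri 0 A ->
  utri 0 (A ^+ k) /\ (A ^+ k) i i = A i i ^+ k.
Proof.
move=> uA; elim: k => [|k [uAk IH]].
  rewrite !expr0; split; last by rewrite mxE eqxx.
  by move=> a b; rewrite addn0 mxE ltn_neqAle eq_sym -val_eqE => /andP[/negbTE-> _].
rewrite !exprS; split; first exact: (utriM uA uAk).
by rewrite -IH; apply: (@utri_mul_diagl 0); rewrite ?addn0.
Qed.

Lemma utri_nilpotent A k : utri 0 A -> A ^+ k = 0 -> utri 1 A.
Proof.
move=> uA Ak i j; rewrite addn1 ltnS leq_eqVlt => /orP[/eqP/val_inj->|ji];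
  last by rewrite uA ?addn0.
have [_] := utri_exp_diag k i uA; rewrite Ak mxE => /esym/eqP.
by rewrite expf_eq0 => /andP[_ /eqP].
Qed.

End Utri.

(** * Lie algebras and matrices of their endomorphisms *)

Section LieBasics.
Variables (F : fieldType) (L : lieAlgType F).
Implicit Types (x y z : L) (U V W : {vspace L}) (d : 'End(L)).

HB.instance Definition _ x := GRing.isSemilinear.Build F L L *:%R (lie x)
  (GRing.semilinear_linear (lie_linear_r x)).

Lemma lieDl x y z : lie (x + y) z = lie x z + lie y z.
Proof. by have := lie_linear_l z 1 x y; rewrite !scale1r. Qed.

Lemma lie0l z : lie 0 z = 0.
Proof. by apply: (addIr (lie 0 z)); rewrite -lieDl !add0r. Qed.

Lemma lieZl a x z : lie (a *: x) z = a *: lie x z.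
Proof. by have := lie_linear_l z a x 0; rewrite addr0 => ->; rewrite lie0l addr0. Qed.

Lemma lieC x y : lie x y = - lie y x.
Proof.
apply/eqP; rewrite -addr_eq0; have := liexx (x + y).
by rewrite lieDl !linearD /= !liexx add0r addr0 addrC => ->.
Qed.

Lemma lie_derl x y z : lie x (lie y z) = lie (lie x y) z + lie y (lie x z).
Proof.
have /eqP := lie_jacobi x y z.
rewrite -addrA addr_eq0 => /eqP->; rewrite opprD addrC (lieC _ (lie x y)).
by rewrite opprK (lieC z x) linearN opprK.
Qed.

Lemma lie_derr x y z : lie (lie x y) z = lie (lie x z) y + lie x (lie y z).
Proof. by rewrite (lie_derl x y z) (lieC (lie x z) y) addrCA addNr addr0. Qed.

(** Bracketing on the left, so the opposite sign to the convention of [InDer]. *)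
Definition ad x : 'End(L) := linfun (lie x).

Lemma adE x y : ad x y = lie x y.
Proof. by rewrite lfunE. Qed.

Lemma ad_is_linear : linear ad.
Proof. by move=> a x y; apply/lfunP=> z; do !rewrite lfunE /=; rewrite lieDl lieZl. Qed.

HB.instance Definition _ := GRing.isSemilinear.Build F L 'End(L) *:%R ad
  (GRing.semilinear_linear ad_is_linear).

Lemma Der_ad x : Der L (ad x).
Proof. by move=> y z; rewrite !adE lie_derl. Qed.

Lemma Der_lin a d d' : Der L d -> Der L d' -> Der L (a *: d + d').
Proof.
move=> Dd Dd' x y; rewrite !add_lfunE !scale_lfunE Dd Dd' lieDl lieZl linearP scalerDr.
by rewrite -!addrA; congr (_ + _); rewrite addrCA.
Qed.

Lemma mem_lie_prodv U V x y : x \in U -> y \in V -> lie x y \in lie_prodv U V.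
Proof.
move=> xU yV; rewrite (coord_vbasis xU) (coord_vbasis yV) linear_sum memv_suml // => j _.
rewrite linearZ /= memvZ // lieC memvN linear_sum memv_suml // => i _.
rewrite linearZ /= memvZ // lieC memvN memv_span //.
by apply/allpairsP; exists ((vbasis U)`_i, (vbasis V)`_j); split; rewrite //= mem_nth ?size_tuple.
Qed.

(** [P] is an arbitrary proposition, so that existence statements can be proved on a product as
    well. *)
Lemma lie_prodv_ind U V (P : L -> Prop) : P 0 ->
  (forall a x y, P x -> P y -> P (a *: x + y)) ->
  (forall x y, x \in U -> y \in V -> P (lie x y)) ->
  forall z, z \in lie_prodv U V -> P z.
Proof.
move=> P0 PL Pl z zUV.
rewrite (coord_span (X := in_tuple [seq lie u v | u <- vbasis U, v <- vbasis V]) zUV).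
elim/big_ind: _ => // [x y Px Py|i _]; first by rewrite -[x]scale1r; apply: PL.
rewrite -[_ *: _]addr0; apply: PL => //.
have: ([seq lie u v | u <- vbasis U, v <- vbasis V])`_i \in
    [seq lie u v | u <- vbasis U, v <- vbasis V].
  exact: mem_nth.
by case/allpairsP => -[x y] /= [/vbasis_mem xU /vbasis_mem yV ->]; apply: Pl.
Qed.

Lemma lie_prodv_sub U V W :
  (forall x y, x \in U -> y \in V -> lie x y \in W) -> (lie_prodv U V <= W)%VS.
Proof.
move=> UVW; apply/subvP; apply: lie_prodv_ind => //; first exact: mem0v.
by move=> a x y xW yW; rewrite memvD ?memvZ.
Qed.

Lemma lie_ideal_prodv U : lie_ideal U -> lie_ideal (lie_prodv U U).
Proof.
move=> idU x; apply: lie_prodv_ind => [|a y z ? ?|y z yU zU].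
- by rewrite linear0 mem0v.
- by rewrite linearD linearZ memvD ?memvZ.
- by rewrite lie_derl memvD // mem_lie_prodv // idU.
Qed.

Lemma lie_ideal_derived U n : lie_ideal U -> lie_ideal (derived_series U n).
Proof. by move=> idU; elim: n => //= n IH; apply: lie_ideal_prodv. Qed.

Lemma derived_sub U n : lie_ideal U -> (derived_series U n <= U)%VS.
Proof.
move=> idU; elim: n => //= n IH; apply: lie_prodv_sub => x y xU yU.
exact/idU/(subvP IH).
Qed.

Lemma derived_mono U V n : (U <= V)%VS -> (derived_series U n <= derived_series V n)%VS.
Proof.
move=> UV; elim: n => //= n IH; apply: lie_prodv_sub => x y xU yU.
by rewrite mem_lie_prodv // (subvP IH).
Qed.

Lemma ad_lower_central U n x y : x \in U -> y \in U ->
  iter n (ad x) y \in lower_central U n.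
Proof.
move=> xU yU; elim: n => //= n IH.
by rewrite adE lieC memvN mem_lie_prodv.
Qed.

Lemma ad_nilpotent_ideal U x : lie_ideal U -> lie_nilpotent U -> x \in U ->
  nilpotent_end (ad x).
Proof.
(* One application of [ad x] brings [y] into [U], and [n] more reach the zero term of the lower
   central series. *)
move=> idU [n Un] xU; exists n.+1 => y; rewrite iterSr adE lieC.
have := @ad_lower_central U n x (- lie y x) xU.
by rewrite Un memv0 memvN => /(_ (idU _ _ xU)) /eqP.
Qed.

Section InBasis.
Variable e : (\dim {:L}).-tuple L.
Hypothesis e_basis : basis_of {:L} e.

Lemma mx_endE d i j : mx_end e d i j = coord e i (d e`_j).
Proof. by rewrite !mxE /= vecof_delta. Qed.

Lemma mx_end_is_linear : linear (mx_end e).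
Proof. by move=> a d d'; rewrite /mx_end mxof_linear linearP. Qed.

HB.instance Definition _ := GRing.isSemilinear.Build F 'End(L) _ *:%R (mx_end e)
  (GRing.semilinear_linear mx_end_is_linear).

Lemma mx_end_lin a d d' i j :
  mx_end e (a *: d + d') i j = a * mx_end e d i j + mx_end e d' i j.
Proof. by rewrite linearP [LHS]mxE [X in X + _]mxE. Qed.

Lemma mx_end_inj : injective (mx_end e).
Proof. by move=> d d' /trmx_inj; apply: (can_inj (mxofK e_basis e_basis)). Qed.

Lemma mx_endM d d' : mx_end e (d \o d')%VF = mx_end e d *m mx_end e d'.
Proof. by rewrite /mx_end (mxof_comp e _ e_basis) trmx_mul. Qed.

Lemma mx_end_nilpotent d : nilpotent_end d <-> exists k, mx_end e d ^+ k = 0.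
Proof.
have it k : exists2 d' : 'End(L),
    (forall x, iter k d x = d' x) & mx_end e d' = mx_end e d ^+ k.
  elim: k => [|k [d' dE mE]].
    exists \1%VF => [x|]; first by rewrite lfunE.
    by rewrite /mx_end mxof1 ?(basis_free e_basis) // trmx1.
  exists (d \o d')%VF => [x|]; first by rewrite lfunE /= dE.
  by rewrite mx_endM mE exprS.
split=> -[k dk]; exists k; have [d' dE mE] := it k.
  rewrite -mE; suff -> : d' = 0 by rewrite linear0.
  by apply/lfunP=> x; rewrite -dE dk lfunE.
move=> x; rewrite dE; suff -> : d' = 0 by rewrite lfunE.
by apply: mx_end_inj; rewrite linear0 mE.
Qed.

Lemma upper_triangularP d : upper_triangular e d <-> utri 0 (mx_end e d).
Proof. by split=> ud i j; have := ud i j; rewrite addn0. Qed.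

Lemma diagonal_part_basis d (i : 'I_(\dim {:L})) :
  diagonal_part e d e`_i = mx_end e d i i *: e`_i.
Proof.
rewrite /diagonal_part hommxE // rVofE // -rowE row_diag_mx.
by rewrite linearZ /= vecof_delta mxE.
Qed.

Lemma lfun_basisP d d' : (forall i : 'I_(\dim {:L}), d e`_i = d' e`_i) -> d = d'.
Proof.
move=> E; apply: mx_end_inj; apply/matrixP=> i j.
by rewrite !mx_endE E.
Qed.

Lemma diagonal_part_is_linear : linear (diagonal_part e).
Proof.
move=> a d d'; apply: lfun_basisP => i.
by rewrite add_lfunE scale_lfunE !diagonal_part_basis mx_end_lin scalerDl scalerA.
Qed.

HB.instance Definition _ := GRing.isSemilinear.Build F 'End(L) 'End(L) *:%R (diagonal_part e)
  (GRing.semilinear_linear diagonal_part_is_linear).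

Lemma coord_app d i x :
  coord e i (d x) = \sum_j mx_end e d i j * coord e j x.
Proof.
rewrite {1}(coord_basis e_basis (memvf x)) !linear_sum /=.
by apply: eq_bigr => j _; rewrite !linearZ /= mulrC mx_endE.
Qed.

Lemma mx_end_diagonal_part d i : mx_end e (diagonal_part e d) i i = mx_end e d i i.
Proof.
rewrite mx_endE diagonal_part_basis linearZ /= coord_free ?(basis_free e_basis) //.
by rewrite eqxx mulr1.
Qed.

Lemma diagonal_part_eq0 d : diagonal_part e d = 0 <-> forall i, mx_end e d i i = 0.
Proof.
split=> [d0 i|d0]; last first.
  by apply: lfun_basisP => i; rewrite diagonal_part_basis d0 scale0r lfunE.
have := diagonal_part_basis d i; rewrite d0 lfunE /= => /esym/eqP.
rewrite scaler_eq0 => /orP[/eqP//|].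
have ei : e`_i \in e by rewrite mem_nth ?size_tuple.
by rewrite (negbTE (basis_not0 e_basis ei)).
Qed.

End InBasis.
End LieBasics.

(** * The semidirect product with a torus *)

Section Semidirect.
Variables (F : fieldType) (N : lieAlgType F) (T : {vspace 'End(N)}).

(** The torus proof is a parameter of the type, so that the Lie algebra instance, whose Jacobi
    identity rests on it, can be attached. *)
Definition semidirect of is_torus T : Type := (N * subvs_of T)%type.

Variable T_torus : is_torus T.
Local Notation NT := (semidirect T_torus).

HB.instance Definition _ := Vector.copy NT (N * subvs_of T)%type.

Definition semidirect_lie (x y : NT) : NT :=
  (lie x.1 y.1 + vsval x.2 y.1 - vsval y.2 x.1, 0).

Fact semidirect_lie_linear_l z : linear (semidirect_lie^~ z).
Proof.
move=> a x y; congr pair; last by rewrite /= scaler0 addr0.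
rewrite /= lieDl lieZl linearP add_lfunE scale_lfunE linearP scalerBr scalerDr /=.
by rewrite scalerN [RHS]addrACA (addrACA (a *: lie _ _)).
Qed.

Fact semidirect_lie_linear_r z : linear (semidirect_lie z).
Proof.
move=> a x y; congr pair; last by rewrite /= scaler0 addr0.
rewrite /= !linearP add_lfunE scale_lfunE scalerBr scalerDr /=.
by rewrite opprD [RHS]addrACA (addrACA (a *: lie _ _)).
Qed.

Fact semidirect_liexx x : semidirect_lie x x = 0.
Proof. by rewrite /semidirect_lie liexx add0r subrr. Qed.

Fact semidirect_jacobi x y z :
  semidirect_lie x (semidirect_lie y z) + semidirect_lie y (semidirect_lie z x)
    + semidirect_lie z (semidirect_lie x y) = 0.
Proof.
have [T_der T_comm _] := T_torus.
case: x y z => [a s] [b t] [c u]; congr pair; last by rewrite /= !addr0.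
rewrite /= !lfunE /= !subr0.
have comm (v w : subvs_of T) n : vsval v (vsval w n) = vsval w (vsval v n).
  by have /lfunP/(_ n) := T_comm _ _ (subvsP v) (subvsP w); rewrite !lfunE.
rewrite !(linearD, linearB) /= !linearN /= !(T_der _ (subvsP _)).
rewrite (comm t s) (comm u s) (comm u t).
have J := lie_jacobi a b c; 
rewrite [lie a (lie _ _)](_ : _ = - lie b (lie c a) - lie c (lie a b)); last first.
  by apply/eqP; rewrite -subr_eq0 opprD !opprK addrA J.
rewrite (lieC (vsval s b)) (lieC (vsval t c)) (lieC (vsval u a)).
(* In coordinates what remains is a scalar identity. *)
apply: (can_inj (rVofK (vbasisP {:N}))); apply/rowP=> i.
by rewrite !(linearD, linearN, mxE) /= linear0; ring.
Qed.

HB.instance Definition _ := isLieAlgebra.Build F NT semidirect_lie_linear_l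
  semidirect_lie_linear_r semidirect_liexx semidirect_jacobi.

Lemma dim_semidirect : \dim {:NT} = (\dim {:N} + \dim T)%N.
Proof. by rewrite !dimvf. Qed.

Definition semidirect_inj (x : N) : NT := (x, 0).
Fact semidirect_inj_linear : linear semidirect_inj.
Proof. by move=> a x y; congr pair; rewrite /= scaler0 addr0. Qed.
HB.instance Definition _ := GRing.isSemilinear.Build F N NT *:%R semidirect_inj
  (GRing.semilinear_linear semidirect_inj_linear).

Definition semidirect_iota : 'Hom(N, NT) := linfun semidirect_inj.

Lemma mem_semidirect_iota (v : NT) : (v \in limg semidirect_iota) = (v.2 == 0).
Proof.
apply/memv_imgP/eqP => [[x _ ->]|v0]; first by rewrite lfunE.
by exists v.1; rewrite ?memvf // lfunE /= [v in LHS]surjective_pairing v0.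
Qed.

Lemma semidirect_lie_inj (x y : N) :
  lie (semidirect_inj x) (semidirect_inj y) = semidirect_inj (lie x y).
Proof. by congr pair; rewrite /= !lfunE /= addr0 subr0. Qed.

Lemma semidirect_injE (x : NT) : x.2 = 0 -> x = semidirect_inj x.1.
Proof. by case: x => x t /= ->. Qed.

Lemma semidirect_lie_in (k : nat) (x y : NT) : x.2 = 0 -> y.2 = 0 ->
  x.1 \in lower_central {:N} k -> (lie x y).1 \in lower_central {:N} k.+1.
Proof.
move=> x2 y2 xk; rewrite (semidirect_injE x2) (semidirect_injE y2).
by rewrite semidirect_lie_inj mem_lie_prodv ?memvf.
Qed.

Lemma semidirect_lower_central k (x : NT) :
  x \in lower_central (limg semidirect_iota) k ->
  x.2 = 0 /\ x.1 \in lower_central {:N} k.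
Proof.
elim: k x => [x|k IH].
  by rewrite mem_semidirect_iota => /eqP->; rewrite memvf.
apply: lie_prodv_ind => [|a x y [x2 x1] [y2 y1]|x y /IH[x2 x1]].
- by rewrite mem0v.
- by rewrite /= x2 y2 scaler0 addr0 memvD ?memvZ.
- by rewrite mem_semidirect_iota => /eqP y2; rewrite semidirect_lie_in.
Qed.

(** The torus part is abelian, so the first bracket already lands in [N]; this accounts for the
    shift by one. *)
Lemma semidirect_derived k (x : NT) :
  x \in derived_series {:NT} k.+1 -> x.2 = 0 /\ x.1 \in lower_central {:N} k.
Proof.
elim: k x => [|k IH]; apply: lie_prodv_ind => [|a x y [x2 x1] [y2 y1]|x y].
- by rewrite mem0v.
- by rewrite /= x2 y2 scaler0 addr0 memvD ?memvZ.
- by move=> _ _; split=> //; apply: memvf.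
- by rewrite mem0v.
- by rewrite /= x2 y2 scaler0 addr0 memvD ?memvZ.
- by move=> /IH[x2 x1] /IH[y2 _]; rewrite semidirect_lie_in.
Qed.

(** An element [(x, t)] of a nilpotent ideal acts on [N] as the nilpotent map [ad x + t]; the second
    hypothesis then gives [t = 0], so [N] is the nilradical. *)
Lemma semidirect_extension : lie_nilpotent {:N} ->
  (forall x t, t \in T -> nilpotent_end (ad x + t) -> t = 0) ->
  solvable_extension semidirect_iota.
Proof.
move=> [k Nk] nilT; split.
- apply/eqP/lker0P => x y; rewrite !lfunE => /= -[]//.
- by move=> x y; rewrite !lfunE /= semidirect_lie_inj.
- exists k.+1; apply/eqP; rewrite -subv0; apply/subvP => x /semidirect_derived[x2].
  by rewrite Nk !memv0 => /eqP x1; rewrite (semidirect_injE x2) x1.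
split.
- by move=> x y _; rewrite mem_semidirect_iota.
- exists k; apply/eqP; rewrite -subv0; apply/subvP => x /semidirect_lower_central[x2].
  by rewrite Nk !memv0 => /eqP x1; rewrite (semidirect_injE x2) x1.
move=> V idV nilV; apply/subvP => v /(ad_nilpotent_ideal idV nilV)[m adv].
rewrite mem_semidirect_iota; apply/eqP/val_inj.
apply: (nilT v.1); first exact: subvsP.
exists m => x; have := adv (semidirect_inj x).
have -> : iter m (ad v) (semidirect_inj x) = semidirect_inj (iter m (ad v.1 + vsval v.2) x).
  elim: m {adv} => //= m ->; rewrite adE; congr pair.
  by rewrite /= add_lfunE adE zero_lfunE subr0.
by case.
Qed.

End Semidirect.

(** * Derivations of a d-locally diagonalizable algebra *)

(** Induction on [s]: on the line [v + c w] the product of the functionals is a nonzero polynomial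
    in [c], as each factor is nonzero at [v] or at [w]. *)
Lemma generic_vector (F : numFieldType) (vT : vectType F) (U : {vspace vT})
    (I : eqType) (s : seq I) (f : I -> vT -> F) :
  (forall i a u v, f i (a *: u + v) = a * f i u + f i v) ->
  (forall i, i \in s -> exists2 u, u \in U & f i u != 0) ->
  exists2 u, u \in U & forall i, i \in s -> f i u != 0.
Proof.
move=> flin; elim: s => [|i s IH] ex; first by exists 0; rewrite ?mem0v.
have [|v vU vs] := IH; first by move=> j js; apply: ex; rewrite inE js orbT.
have [w wU wi] := ex i (mem_head i s).
pose p := \prod_(j <- i :: s) ((f j v)%:P + (f j w) *: 'X).
have [|c pc] := @poly_nonroot F p.
  rewrite prodf_seq_neq0; apply/allP => j; rewrite inE => jis; apply/eqP => /polyP E.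
  have := E 0; have := E 1.
  rewrite !coefD !coefZ !coefX !coefC /= !mulr0 !mulr1 add0r addr0 => fjw fjv.
  case/orP: jis => [/eqP ji|/vs]; last by rewrite fjv eqxx.
  by rewrite -ji fjw eqxx in wi.
exists (c *: w + v) => [|j js]; first by rewrite memvD ?memvZ.
rewrite flin; move: pc; rewrite horner_prod prodf_seq_neq0 => /allP/(_ j js) /=.
by rewrite hornerD hornerC hornerZ hornerX addrC mulrC.
Qed.

Section Derivations.
Variables (F : numFieldType) (N : lieAlgType F).
Implicit Types d t : 'End(N).

Lemma nilpotent_endZ a d : a != 0 -> nilpotent_end (a *: d) -> nilpotent_end d.
Proof.
move=> a0 [k dk]; exists k => x.
have /eqP := dk x; suff -> : iter k (a *: d) x = a ^+ k *: iter k d x.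
  by rewrite scaler_eq0 expf_eq0 (negbTE a0) andbF => /eqP.
elim: k {dk} => [|k IH]; first by rewrite scale1r.
by rewrite !iterS IH scale_lfunE linearZ scalerA exprS.
Qed.

Lemma nil_independent_der1 d : Der N d -> ~ nilpotent_end d -> nil_independent_der d.
Proof.
move=> Dd nd; exists [:: d]; split; rewrite ?mem_head //.
  by move=> d'; rewrite inE => /eqP->.
move=> c [i ci]; rewrite big_ord1 => /nilpotent_endZ => /(_ _)/nd; apply.
by move: ci; rewrite (ord1 i).
Qed.

(* A nilpotent derivation [d] is a combination of the non-nilpotent ones [d0]
   and [d0 + c d], where [c <> 0] is chosen with [d0 + c d] not nilpotent. *)
Lemma Der_nil_independent_ind (P : 'End(N) -> Prop) :
  ~ characteristically_nilpotent N ->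
  (forall a d d', P d -> P d' -> P (a *: d + d')) ->
  (forall d, nil_independent_der d -> P d) -> forall d, Der N d -> P d.
Proof.
move=> ncn Plin Pnil d Dd.
have [d0 /not_implyP[Dd0 nd0]] : exists d, ~ (Der N d -> nilpotent_end d).
  exact/existsNP.
have Pd0 : P d0 by apply/Pnil/nil_independent_der1.
have P0 : P 0 by rewrite -(subrr d0) addrC -scaleN1r; apply: Plin.
have [nd|] := pselect (nilpotent_end d); last first.
  by move=> nd; apply/Pnil/nil_independent_der1.
have eb := vbasisP {:N}.
have [[c [c0 nc]]|nex] :=
    pselect (exists c, c != 0 /\ ~ nilpotent_end (d0 + c *: d)); last first.
  (* If no such [c] existed, [d0] would be nilpotent as the limit at [c = 0]. *)
  case: nd0; apply/(mx_end_nilpotent eb); exists (\dim {:N}).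
  apply: (@mx_nilpotent_limit _ _ _ (mx_end (vbasis {:N}) d)) => c c0.
  have [/(mx_end_nilpotent eb)[k]|] := pselect (nilpotent_end (d0 + c *: d)); last first.
    by move=> nc; case: nex; exists c.
  by rewrite linearD linearZ; exists k.
have -> : d = c^-1 *: (d0 + c *: d) + ((- c^-1) *: d0 + 0).
  by rewrite addr0 scalerDr scalerA mulVf // scale1r scaleNr addrAC subrr add0r.
apply: (Plin); last exact: Plin.
by apply/Pnil/nil_independent_der1 => //; rewrite addrC; apply: Der_lin.
Qed.

(** * Triangular form of derivations and weights of the torus *)

Hypothesis ncn : ~ characteristically_nilpotent N.
Variables (e : (\dim {:N}).-tuple N) (T : {vspace 'End(N)}).
Hypotheses (e_basis : basis_of {:N} e)
  (triangular : forall d, nil_independent_der d -> upper_triangular e d)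
  (generated : diagonals_generate e T)
  (diagonal : diagonal_on_root_spaces e T)
  (root0 : ~ is_root (0 : torus_dual T)).

Local Notation wt t i := (mx_end e t i i).

Lemma Der_utri d : Der N d -> utri 0 (mx_end e d).
Proof.
move: d; apply: (Der_nil_independent_ind ncn) => [a x y ux uy i j ij|x];
  last by move/triangular/upper_triangularP.
by rewrite mx_end_lin ux // uy // mulr0 addr0.
Qed.

Lemma Der_diagonal_part d : Der N d -> diagonal_part e d \in T.
Proof.
move: d; apply: (Der_nil_independent_ind ncn) => [a x y ux uy|x]; last exact: generated.1.
by rewrite [diagonal_part _ _]linearP memvD ?memvZ.
Qed.

Lemma Der_strict d : Der N d -> diagonal_part e d = 0 <-> utri 1 (mx_end e d).
Proof.
move=> Dd; rewrite (diagonal_part_eq0 e_basis); split=> [d0 i j|ud i]; last by rewrite ud ?addn1.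
rewrite addn1 ltnS leq_eqVlt => /orP[/eqP/val_inj->//|ji].
by apply: Der_utri; rewrite ?addn0.
Qed.

Lemma Der_nilpotent_strict d : Der N d -> nilpotent_end d -> utri 1 (mx_end e d).
Proof.
move=> Dd /(mx_end_nilpotent e_basis)[k]; apply: utri_nilpotent; exact: Der_utri.
Qed.

(** [T] is the least space containing the diagonals, so it lies in the image of the idempotent map
    [diagonal_part e]. *)
Lemma torus_diagonal t : t \in T -> diagonal_part e t = t.
Proof.
have /subvP TD : (T <= limg (linfun (diagonal_part e)))%VS.
  by apply: generated.2 => d _; rewrite -[diagonal_part e d]lfunE memv_img ?memvf.
move/TD/memv_imgP => -[d _]; rewrite lfunE => -> /=.
apply: (lfun_basisP e_basis) => i.
by rewrite !diagonal_part_basis // mx_end_diagonal_part.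
Qed.

Lemma torus_basis t (i : 'I_(\dim {:N})) : t \in T -> t e`_i = wt t i *: e`_i.
Proof. by move=> tT; rewrite -{1}(torus_diagonal tT) diagonal_part_basis. Qed.

Lemma weight_neq0 i : exists2 t, t \in T & wt t i != 0.
Proof.
apply: contrapT => nex; apply: root0; exists e`_i; last first.
  by rewrite (basis_not0 e_basis) // mem_nth // size_tuple.
move=> t; rewrite torus_basis ?subvsP // lfunE /= scale0r.
have [->|wi] := eqVneq (wt (vsval t) i) 0; first by rewrite scale0r.
by case: nex; exists (vsval t); rewrite ?subvsP.
Qed.

Let weight_fun j (t : subvs_of T) : F^o := wt (vsval t) j.
Let weight_fun_linear j : linear (weight_fun j).
Proof. by move=> a x y; rewrite /weight_fun [vsval _]linearP mx_end_lin. Qed.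
HB.instance Definition _ j := GRing.isSemilinear.Build F (subvs_of T) F^o *:%R
  (weight_fun j) (GRing.semilinear_linear (weight_fun_linear j)).

(** [e_i] and [e_j] lie in one root space, on which the projection of a nil-independent derivation
    is diagonal; [Der_nil_independent_ind] extends this to all derivations. *)
Lemma Der_same_weight d i j : Der N d -> i != j ->
  (forall t, t \in T -> wt t i = wt t j) -> mx_end e d i j = 0.
Proof.
move=> Dd ij wij; move: d Dd.
apply: (Der_nil_independent_ind ncn) => [a x y ux uy|d nd].
  by rewrite mx_end_lin ux uy mulr0 addr0.
pose w l : torus_dual T := linfun (weight_fun l).
have w_root l : root_space (w l) e`_l.
  by move=> t; rewrite torus_basis ?subvsP // /w lfunE.
have [|pi [pi1 pi0] piD] := @diagonal (w j).
  by exists e`_j; [exact: w_root|rewrite (basis_not0 e_basis) // mem_nth // size_tuple].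
have /vlineP[k dk] := piD d nd j (w_root j).
have : coord e i (pi (d e`_j)) = 0.
  by rewrite dk linearZ /= coord_free ?(basis_free e_basis) // eq_sym (negbTE ij) mulr0.
(* The projection fixes [e_i] and fixes or kills every other basis vector, so this coordinate is
   exactly the matrix entry [(i, j)] of [d]. *)
rewrite {1}(coord_basis e_basis (memvf (d e`_j))) linear_sum linear_sum (bigD1 i) //= big1.
  have wji : w i = w j by apply/lfunP => t; rewrite !lfunE; apply: wij; exact: subvsP.
  rewrite addr0 linearZ linearZ /= pi1; last by rewrite -wji; exact: w_root.
  by rewrite coord_free ?(basis_free e_basis) // eqxx mulr1 -mx_endE.
move=> l li; rewrite linearZ linearZ /=.
have [E|/eqP E] := eqVneq (w l) (w j).
  by rewrite pi1 -?E; [rewrite coord_free ?(basis_free e_basis) // (negbTE li) mulr0|exact: w_root].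
by rewrite (pi0 _ E _ (w_root l)) linear0 mulr0.
Qed.

(** Only the diagonal of [t] enters, so that the notion also applies to triangular derivations
    outside [T]. *)
Definition generic_weights t :=
  (forall i, wt t i != 0) /\
  (forall i j, wt t i = wt t j -> forall t', t' \in T -> wt t' i = wt t' j).

Lemma generic_torus_element : exists2 t, t \in T & generic_weights t.
Proof.
(* [(i, None)] encodes the weight of [e_i] and [(i, Some j)] a difference of weights; [s] keeps
   those that are nonzero on [T]. *)
pose f (x : 'I_(\dim {:N}) * option 'I_(\dim {:N})) t :=
  wt t x.1 - if x.2 is Some j then wt t j else 0.
have flin x a u v : f x (a *: u + v) = a * f x u + f x v.
  rewrite /f mx_end_lin mulrBr addrACA -opprD; congr (_ - _).
  by case: x.2 => [j|]; rewrite ?mx_end_lin ?mulr0 ?addr0.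
pose s := [seq x <- enum {: 'I_(\dim {:N}) * option 'I_(\dim {:N})}
             | `[< exists2 t, t \in T & f x t != 0 >]].
have [|t tT tf] := generic_vector (s := s) (U := T) flin.
  by move=> x; rewrite mem_filter => /andP[/asboolP].
exists t => //; split=> [i|i j tij t' t'T].
  have := tf (i, None); rewrite /f subr0; apply.
  rewrite mem_filter mem_enum andbT; apply/asboolP.
  by have [u uT ui] := weight_neq0 i; exists u; rewrite /f ?subr0.
apply/eqP; rewrite -subr_eq0; apply/negPn/negP => t'ij.
have := tf (i, Some j); rewrite /f /= tij subrr eqxx => H.
suff: (i, Some j) \in s by move/H.
by rewrite mem_filter mem_enum andbT; apply/asboolP; exists t'.
Qed.

(* In the first superdiagonal on which [d] might be nonzero, the entry
   [(i, j)] of [s d - d s] is [(s_ii - s_jj) d_ij]. *)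
Lemma Der_strict_commuting_eq0 s d : Der N s -> Der N d ->
  generic_weights s -> utri 1 (mx_end e d) ->
  (s \o d = d \o s)%VF -> d = 0.
Proof.
move=> Ds Dd [_ gs] ud /(congr1 (mx_end e)); rewrite !mx_endM // => sd.
apply: (mx_end_inj e_basis); rewrite linear0.
suff ukd k : utri k.+1 (mx_end e d) by apply: (@utri_big _ _ (\dim {:N}).+1).
elim: k => // k IH i j; rewrite addnS ltnS leq_eqVlt => /orP[/eqP ij|]; last exact: IH.
have := utri_mul_diagl (Der_utri Ds) IH ij.
rewrite sd (utri_mul_diagr (Der_utri Ds) IH ij) mulrC => /eqP.
rewrite -subr_eq0 -mulrBl mulf_eq0 => /orP[|/eqP//].
rewrite subr_eq0 => /eqP sij; apply: Der_same_weight => //; last exact: gs.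
by apply/eqP => E; move: ij => /eqP;
  rewrite E -{1}[nat_of_ord j]addn0 eqn_add2l.
Qed.

Lemma Der_triangular_inj d :
  Der N d -> (forall i, wt d i != 0) -> lker d == 0%VS.
Proof.
(* [mxof] is the transpose of [mx_end], hence lower triangular, and its determinant is the product
   of the diagonal entries. *)
move=> Dd d0; have trig : is_trig_mx (mxof e e d).
  apply/is_trig_mxP => i j ij.
  by have := Der_utri Dd (i := j) (j := i); rewrite addn0 mxE; apply.
have unit : mxof e e d \in unitmx.
  rewrite unitmxE unitfE (det_trig trig) prodf_seq_neq0; apply/allP => i _ /=.
  by have := d0 i; rewrite mxE.
rewrite -subv0; apply/subvP => x; rewrite memv_ker memv0 => /eqP dx.
rewrite -(rVof_eq0 e_basis) -(mulmxK unit (rVof e x)) -rVof_app //.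
by rewrite dx linear0 mul0mx.
Qed.

Hypotheses (T_torus : is_torus T) (N_nil : lie_nilpotent {:N}).

Lemma ad_strict x : utri 1 (mx_end e (ad x)).
Proof.
apply: Der_nilpotent_strict; first exact: Der_ad.
by apply: (ad_nilpotent_ideal (U := {:N})) => // [u v _|]; apply: memvf.
Qed.

(** [ad x] is strictly triangular, so [ad x + t] has the diagonal of [t], which vanishes if the sum
    is nilpotent. *)
Lemma torus_extension : solvable_extension (semidirect_iota T_torus).
Proof.
apply: semidirect_extension => // x t tT nil.
have Dt : Der N t by case: T_torus => + _ _; apply.
have Dxt : Der N (ad x + t) by rewrite -[ad x]scale1r; apply: Der_lin => //; apply: Der_ad.
rewrite -(torus_diagonal tT); apply/(diagonal_part_eq0 e_basis) => i.
have := Der_nilpotent_strict Dxt nil (i := i) (j := i).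
rewrite addn1 ltnSn => /(_ isT).
by rewrite linearD mxE ad_strict ?addn1 // add0r.
Qed.

(** * Maximal solvable extensions *)

Variables (L : lieAlgType F) (iota : 'Hom(N, L)).
Hypothesis L_max : maximal_solvable_extension iota.

Let iota_inj : lker iota == 0%VS.
Proof. by case: L_max => -[-> *]. Qed.

Let iota_lie x y : iota (lie x y) = lie (iota x) (iota y).
Proof. by case: L_max => -[]. Qed.

Let L_solvable : lie_solvable {:L}.
Proof. by case: L_max => -[]. Qed.

Let iota_ideal : lie_ideal (limg iota).
Proof. by case: L_max => -[_ _ _ []]. Qed.

Let iota_max V : lie_ideal V -> lie_nilpotent V -> (V <= limg iota)%VS.
Proof. by case: L_max => -[_ _ _ [_ _]] + _; apply. Qed.

Let iotaP y : y \in limg iota -> exists x, y = iota x.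
Proof. by case/memv_imgP => x _ ->; exists x. Qed.

(** * Restriction of endomorphisms of the extension to the nilradical *)

Definition stab (D : 'End(L)) := forall x, D (iota x) \in limg iota.
(** Meaningful as a restriction when [stab D] holds, since [iota^-1] inverts [iota] only on its
    image; linear in [D] without that condition. *)
Definition restr (D : 'End(L)) : 'End(N) := (iota^-1 \o D \o iota)%VF.

Lemma restrE D x : stab D -> iota (restr D x) = D (iota x).
Proof. by move=> sD; rewrite !lfunE /= lfunE /= limg_lfunVK. Qed.

Lemma restr_is_linear : linear restr.
Proof. by move=> a D D'; rewrite /restr !(comp_lfunDr, comp_lfunDl) -comp_lfunZr -!comp_lfunZl. Qed.
HB.instance Definition _ := GRing.isSemilinear.Build F 'End(L) 'End(N) *:%R restr
  (GRing.semilinear_linear restr_is_linear).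

Lemma stab_ad x : stab (ad x).
Proof. by move=> y; rewrite adE iota_ideal ?memv_img ?memvf. Qed.

Lemma Der_restr D : Der L D -> stab D -> Der N (restr D).
Proof.
move=> DD sD x y; apply: (lker0P iota_inj).
by rewrite linearD /= !iota_lie !restrE // iota_lie DD.
Qed.

Lemma restr_ad_iota x : restr (ad (iota x)) = ad x.
Proof.
apply/lfunP=> y; apply: (lker0P iota_inj).
by rewrite restrE ?adE ?iota_lie //; apply: stab_ad.
Qed.

(** The identity [ad (D x) = [D, ad x]], carried over to [N]. *)
Lemma restr_ad_Der D x : Der L D -> stab D ->
  restr (ad (D x)) = (restr D \o restr (ad x))%VF - (restr (ad x) \o restr D)%VF.
Proof.
move=> DD sD; apply/lfunP=> y; apply: (lker0P iota_inj); have sx := stab_ad.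
rewrite restrE // add_lfunE opp_lfunE linearB /=.
rewrite (comp_lfunE (restr D)) (comp_lfunE _ (restr D)) !restrE //.
by rewrite !adE DD addrK.
Qed.

(** * The diagonal map from the extension to the torus *)

Definition ad_diagonal x := diagonal_part e (restr (ad x)).
Lemma ad_diagonal_is_linear : linear ad_diagonal.
Proof. by move=> a x y; rewrite /ad_diagonal !linearP. Qed.
HB.instance Definition _ := GRing.isSemilinear.Build F L 'End(N) *:%R ad_diagonal
  (GRing.semilinear_linear ad_diagonal_is_linear).

Lemma Der_restr_ad x : Der N (restr (ad x)).
Proof. by apply: Der_restr; [exact: Der_ad|exact: stab_ad]. Qed.

(** A commutator of upper triangular matrices has zero diagonal. *)
Lemma ad_diagonal_Der D x : Der L D -> stab D -> ad_diagonal (D x) = 0.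
Proof.
move=> DD sD; apply/(diagonal_part_eq0 e_basis) => i.
have uD := Der_utri (Der_restr DD sD); have ux := Der_utri (Der_restr_ad x).
rewrite restr_ad_Der // -scaleN1r addrC mx_end_lin !mx_endM // mulN1r.
by rewrite !(@utri_mul_diagl _ _ 0) ?addn0 // mulrC addNr.
Qed.

Lemma ad_diagonal_lie x y : ad_diagonal (lie x y) = 0.
Proof. by rewrite -adE ad_diagonal_Der; [|exact: Der_ad|exact: stab_ad]. Qed.

Let K := lker (linfun ad_diagonal).

Let memK x : (x \in K) = (ad_diagonal x == 0).
Proof. by rewrite memv_ker lfunE. Qed.

(* If the kernel [K] were bigger than the nilradical [N], the last term [A] of
   its derived series not contained in [N] would give an ideal [A + N] that
   brackets into [N] and acts strictly triangularly on [N]: it would be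
   nilpotent. *)
Lemma ad_diagonal_ker : K = limg iota.
Proof.
have idK : lie_ideal K by move=> x y _; rewrite memK ad_diagonal_lie.
apply/eqP; rewrite eqEsubv; apply/andP; split; last first.
  apply/subvP => _ /iotaP[x ->]; rewrite memK; apply/eqP.
  by apply/Der_strict; rewrite ?restr_ad_iota; [exact: Der_ad|exact: ad_strict].
(* Take the first term of the derived series of [K] inside the nilradical. If it is [K] itself, the
   claim holds; otherwise the term before it leads to a contradiction. *)
have [|n Kn nmin] := @ex_minnP (fun n => derived_series K n <= limg iota)%VS.
  have [n Ln] := L_solvable; exists n; apply: subv_trans (derived_mono n (subvf K)) _.
  by rewrite Ln sub0v.
case: n Kn nmin => [//|n] Kn nmin.
have : ~~ (derived_series K n <= limg iota)%VS.
  by apply/negP => /nmin; rewrite ltnn.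
case/negP; set A := (derived_series K n + limg iota)%VS.
suff AN : (A <= limg iota)%VS by apply: subv_trans (addvSl _ _) AN.
have idKn := @lie_ideal_derived _ _ _ n idK.
have AK a : a \in A -> utri 1 (mx_end e (restr (ad a))).
  case/memv_addP => u uK [_ /iotaP[x ->] ->].
  have -> : restr (ad (u + iota x)) = 1 *: restr (ad u) + ad x.
    by rewrite scale1r -restr_ad_iota -linearD -linearD.
  move=> i j ij; rewrite mx_end_lin ad_strict // addr0 mul1r.
  have := subvP (@derived_sub _ _ _ n idK) _ uK.
  by rewrite memK => /eqP/(Der_strict (Der_restr_ad u)); apply.
have AA a b : a \in A -> b \in A -> lie a b \in limg iota.
  case/memv_addP => u uK [v vN ->] /memv_addP[u' u'K [v' v'N ->]].
  rewrite lieDl linearD /= -addrA memvD //; first exact/(subvP Kn)/mem_lie_prodv.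
  by rewrite memvD //; [exact: iota_ideal|rewrite lieC memvN; exact: iota_ideal].
apply: iota_max => [x a|].
  case/memv_addP => u uK [v vN ->].
  by rewrite linearD memv_add ?iota_ideal ?idKn.
(* One bracket moves [A] into the nilradical; each further one acts strictly triangularly and makes
   one more of the last coordinates vanish. *)
have lcA k z : z \in lower_central A k.+1 ->
    exists2 x, z = iota x & forall i : 'I__, (\dim {:N} <= i + k)%N -> coord e i x = 0.
  elim: k z => [|k IH]; apply: lie_prodv_ind.
  - by exists 0; rewrite ?linear0 // => i _; rewrite linear0.
  - move=> a _ _ [x -> x0] [y -> y0]; exists (a *: x + y); rewrite ?linearP // => i ik.
    by rewrite linearP /= x0 ?y0 // mulr0 addr0.
  - move=> a b aA bA; have [x ->] := iotaP (AA a b aA bA).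
    by exists x => // i; rewrite addn0 leqNgt ltn_ord.
  - by exists 0; rewrite ?linear0 // => i _; rewrite linear0.
  - move=> a _ _ [x -> x0] [y -> y0]; exists (a *: x + y); rewrite ?linearP // => i ik.
    by rewrite linearP /= x0 ?y0 // mulr0 addr0.
  move=> _ a /IH[x -> x0] aA; exists (- restr (ad a) x).
    by rewrite linearN /= restrE ?adE -?lieC //; exact: stab_ad.
  move=> i ik; rewrite linearN /= coord_app // big1 ?oppr0 // => j _.
  have [ji|ij] := ltnP j (i + 1); first by rewrite (AK _ aA) ?mul0r.
  by rewrite x0 ?mulr0 // (leq_trans ik) // addnS -addSn -addn1 leq_add2r.
exists (\dim {:N}).+1; apply/eqP; rewrite -subv0; apply/subvP => z /lcA[x -> x0].
rewrite (coord_basis e_basis (memvf x)) big1 ?linear0 ?mem0v // => i _.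
by rewrite x0 ?scale0r // leq_addl.
Qed.

(** By rank-nullity the image has dimension [\dim L - \dim N], and maximality against the semidirect
    product makes this at least [\dim T]. *)
Lemma ad_diagonal_onto t : t \in T -> exists x, ad_diagonal x = t.
Proof.
suff <- : limg (linfun ad_diagonal) = T.
  by case/memv_imgP => x _ ->; exists x; rewrite lfunE.
apply/eqP; rewrite eqEdim; apply/andP; split.
  apply/subvP => _ /memv_imgP[x _ ->]; rewrite lfunE.
  exact/Der_diagonal_part/Der_restr_ad.
have := limg_ker_dim (linfun ad_diagonal) {:L}.
rewrite capfv -/K ad_diagonal_ker limg_dim_eq ?(eqP iota_inj) ?capv0 //.
have := L_max.2 _ _ torus_extension; rewrite dim_semidirect => /[swap] <-.
by rewrite leq_add2l.
Qed.

Lemma lie_in_iota x y : lie x y \in limg iota.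
Proof. by rewrite -ad_diagonal_ker memK ad_diagonal_lie. Qed.

Lemma Der_in_iota D x : Der L D -> stab D -> D x \in limg iota.
Proof. by move=> DD sD; rewrite -ad_diagonal_ker memK ad_diagonal_Der. Qed.

(** * Every derivation of the extension is inner *)

Lemma Der_extension_inner : Der L = InDer L.
Proof.
have [t0 t0T gt0] := generic_torus_element.
have [x0 x0t] := ad_diagonal_onto t0T.
pose s := restr (ad x0); have Ds : Der N s := Der_restr_ad x0.
have wts i : wt s i = wt t0 i by rewrite -x0t mx_end_diagonal_part.
have gs : generic_weights s.
  by split=> [i|i j]; rewrite !wts; [exact: gt0.1|exact: gt0.2].
have s_inj := Der_triangular_inj Ds gs.1.
have iota_s x : iota (s x) = lie x0 (iota x) by rewrite restrE ?adE //; exact: stab_ad.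
(* Since [s] is invertible, the nilradical equals its bracket with [x0]; so derivations map it into
   [[L, L]], which it contains. *)
have iota_div x : iota x = lie x0 (iota (s^-1%VF x)).
  by rewrite -iota_s lker0_lfunVK.
have Der_stab D : Der L D -> stab D.
  by move=> DD x; rewrite iota_div DD memvD ?lie_in_iota.
have split x : exists c n, [/\ x = c + iota n & lie x0 c = 0].
  have [m mE] := iotaP (lie_in_iota x0 x).
  exists (x - iota (s^-1%VF m)), (s^-1%VF m); rewrite subrK; split=> //.
  by rewrite linearB /= -iota_div mE subrr.
have Der_eq0 D : Der L D -> D x0 = 0 -> utri 1 (mx_end e (restr D)) -> D = 0.
  move=> DD Dx0 uD; have sD := Der_stab D DD.
  have rD0 : restr D = 0.
    (* [D x0 = 0] turns [restr_ad_Der] into commutation of [restr D] with [s]. *)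
    apply: (Der_strict_commuting_eq0 Ds) => //; first exact: Der_restr.
    apply/eqP; rewrite eq_sym -subr_eq0 -restr_ad_Der // Dx0.
    by rewrite !linear0.
  apply/lfunP=> y; rewrite lfunE /=; have [c [n [-> x0c]]] := split y.
  rewrite linearD /= -(restrE n sD) rD0 zero_lfunE linear0 addr0.
  (* [D c] lies in the nilradical and is killed by [ad x0], which is injective there. *)
  have [m Dc] := iotaP (Der_in_iota c DD sD).
  have /eqP : lie x0 (D c) = 0.
    by apply: (addrI (lie (D x0) c)); rewrite -DD x0c linear0 Dx0 lie0l addr0.
  rewrite Dc -iota_s -(linear0 iota) (inj_eq (lker0P iota_inj)) -(linear0 s).
  by rewrite (inj_eq (lker0P s_inj)) => /eqP->; rewrite !linear0.
apply/seteqP; split=> [D DD|D [x Dx] y z]; last first.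
  by rewrite !Dx lie_derr.
have [m mE] := iotaP (Der_in_iota x0 DD (Der_stab D DD)).
(* [D x0 = [x0, iota n]], so adding [ad (iota n)] cancels the value at [x0]. *)
pose n := s^-1%VF m; pose D1 := D + ad (iota n).
have DD1 : Der L D1 by rewrite /D1 -[D]scale1r; apply: Der_lin => //; exact: Der_ad.
have D1x0 : D1 x0 = 0 by rewrite add_lfunE adE mE iota_div lieC addrC subrr.
(* Choose [x] with the diagonal of [D1], then replace it by its component [c]: the diagonal is the
   same, and [[x0, c] = 0] keeps the value at [x0] zero. *)
have [x xE] := ad_diagonal_onto (Der_diagonal_part (Der_restr DD1 (Der_stab D1 DD1))).
have [c [n' [xc x0c]]] := split x.
pose D2 := (-1) *: ad c + D1.
have DD2 : Der L D2 by apply: Der_lin => //; exact: Der_ad.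
have D20 : D2 = 0.
  apply: Der_eq0 => //.
    by rewrite add_lfunE scale_lfunE adE D1x0 lieC x0c oppr0 scaler0 addr0.
  apply/Der_strict; first by apply: Der_restr => //; exact: Der_stab.
  rewrite /D2 [restr _]linearP [diagonal_part _ _]linearP /= -xE -/(ad_diagonal c) xc.
  have /eqP iota0 : ad_diagonal (iota n') == 0 by rewrite -memK ad_diagonal_ker memv_img ?memvf.
  by rewrite [X in _ + X]linearD /= iota0 addr0 scaleN1r addNr.
(* [D2 = 0] reads [D = ad c - ad (iota n)]; passing to right brackets reverses the sign. *)
exists (iota n - c) => y; rewrite lieC lieDl -[- c]scaleN1r lieZl.
have := congr1 (fun f : 'End(L) => f y) D20.
rewrite /D2 /D1 !add_lfunE scale_lfunE !adE lfunE /= => /eqP.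
rewrite addrCA addr_eq0 => /eqP->.
by rewrite addrC.
Qed.

End Derivations.

Theorem theorem4p5 (R : realType) (N L : lieAlgType R[i])
    (iota : 'Hom(N, L))
    (N_nilpotent : lie_nilpotent {:N})
    (N_not_char_nilpotent : ~ characteristically_nilpotent N)
    (N_diag : d_locally_diagonalizable N)
    (L_max : maximal_solvable_extension iota)
    (L_not_nilpotent : ~ lie_nilpotent {:L}) :
  Der L = InDer L.
Proof.
have [e [T [[eb tri] [[T_torus _] gen] diag root0]]] := N_diag.
exact: (Der_extension_inner N_not_char_nilpotent eb tri gen diag root0 T_torus
  N_nilpotent L_max).
Qed.
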